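(* There is an absolute constant $J>0$ such that the following holds. Let $G=(V,E)$ be a finite simple graph, let $p\in[0,1]$ and let $\lambda:E\to[0,\infty)$. Suppose that the family \[ \mathcal{U}=\{U\subseteq V:\ \lambda(G[U])\geq J^2\lambda(E)\,p^2\} \] is not equal to $2^V$ (equivalently, $p>0$ and $\lambda(E)>0$). Then $\mathcal{U}$ is $p$-small.
   Context: For a set of edges $H$, $\lambda(H)=\sum_{e\in H}\lambda(e)$; $G[U]$ denotes the set of edges of $G$ with both endpoints in $U$. A family $\mathcal{F}\subseteq 2^V$ is $p$-small if there is $\mathcal{G}\subseteq 2^V$ such that every member of $\mathcal{F}$ contains some member of $\mathcal{G}$ and $\sum_{S\in\mathcal{G}}p^{|S|}\leq 1/2$ (with $p^0=1$). *)

(* Defs.v *)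
From HB Require Import structures.
From mathcomp Require Import all_boot all_order all_algebra.
From mathcomp Require Import reals.

Set Implicit Arguments.
Unset Strict Implicit.
Unset Printing Implicit Defensive.

Import Order.TTheory GRing.Theory Num.Theory.
Local Open Scope ring_scope.

Record sgraph (V : finType) := SGraph {
  adj : rel V;
  adj_sym : symmetric adj;
  adj_irrefl : irreflexive adj }.

Definition edges (V : finType) (G : sgraph V) : {set {set V}} :=
  [set e : {set V} | [exists x, exists y, adj G x y && (e == [set x; y])]].

Definition induced_edges (V : finType) (G : sgraph V) (U : {set V})
    : {set {set V}} :=
  [set e in edges G | e \subset U].

(* A weight function on the edges is a total function on {set V}; only its
   values on edges are ever used. *)
Definition weight (R : realType) (V : finType) (lambda : {set V} -> R)
    (H : {set {set V}}) : R :=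
  \sum_(e in H) lambda e.

Definition p_small (R : realType) (V : finType) (p : R)
    (F : {set {set V}}) : Prop :=
  exists GG : {set {set V}},
    (forall A, A \in F -> exists2 S, S \in GG & S \subset A) /\
    \sum_(S in GG) p ^+ #|S| <= 1 / 2.

Definition heavy_family (R : realType) (V : finType) (G : sgraph V)
    (lambda : {set V} -> R) (J p : R) : {set {set V}} :=
  [set U : {set V} | J ^+ 2 * weight lambda (edges G) * p ^+ 2
                       <= weight lambda (induced_edges G U)].

Lemma heavy_family_neqT (R : realType) (V : finType) (G : sgraph V)
    (lambda : {set V} -> R) (J p : R) :
    0 < J -> 0 <= p -> (forall e, e \in edges G -> 0 <= lambda e) ->
  heavy_family G lambda J p <> [set: {set V}] <->
  0 < p /\ 0 < weight lambda (edges G).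
Proof.
move=> J0 p0 l0.
have w_ge0 : 0 <= weight lambda (edges G) by apply: sumr_ge0.
have wU_ge0 U : 0 <= weight lambda (induced_edges G U).
  by apply: sumr_ge0 => e; rewrite inE => /andP[/l0].
split=> [neqT | [p_gt0 w_gt0] eqT].
  rewrite !lt_neqAle p0 w_ge0 !andbT.
  by split; apply/eqP => E0; apply: neqT; apply/setP => U;
     rewrite !inE -E0 ?expr0n ?mulr0 ?mul0r wU_ge0.
have : set0 \in heavy_family G lambda J p by rewrite eqT inE.
rewrite inE leNgt => /negP; apply.
rewrite [X in X < _]big1 ?mulr_gt0 ?exprn_gt0 // => e.
rewrite inE subset0 => /andP[eE /eqP e0]; move: eE; rewrite e0 inE.
case/existsP => x /existsP[y /andP[_ /eqP/setP/(_ x)]].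
by rewrite !inE eqxx.
Qed.

(* Main.v *)
(* A set heavy for [lambda] is forced to contain one of the following cheap
   configurations, with geometric weight classes
   [kappa / 16^(i+1) < lambda e <= kappa / 16^i] and [kappa = 16 p^2 D], where
   [D] sums [lambda] over ordered adjacent pairs.
   - An edge of weight above [kappa], or a set of vertices whose weighted degrees
     sum to a large multiple of their mean (Talagrand's argument for weights on
     points).
   - For some [i] and [s], many disjoint stars with [s] leaves in the graph of
     the [i]-th class, each star having at least [2048 p] times the degree of
     its centre as leaves.
   The cost of packing [m] disjoint members of a family of cost [c] is at most
   [(4/t)^m] whenever [t c <= m], and the family of stars of size [s] costs
   exponentially little in [s] because of the lower bound on the number of
   leaves. Conversely, peeling low-degree vertices and removing closed
   neighbourhoods of maximal-degree vertices splits the edges of any [U] in the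
   [i]-th class into few edges charged to vertex degrees and edges charged to
   disjoint stars, so that without the configurations above [U] is light. *)
Require Import Defs.
From HB Require Import structures.
From mathcomp Require Import all_boot all_order all_algebra.
From mathcomp Require Import reals.
From mathcomp Require Import ring lra zify.
From mathcomp Require boolp exp.

Set Implicit Arguments.
Unset Strict Implicit.
Unset Printing Implicit Defensive.

Import Order.TTheory GRing.Theory Num.Theory.
Local Open Scope ring_scope.

(** * Costs of covers, and packings of disjoint sets *)

Section Covers.

Variables (R : realType) (V : finType) (p : R).
Hypothesis p_ge0 : 0 <= p.

Definition cost (GG : {set {set V}}) : R := \sum_(S in GG) p ^+ #|S|.

(** Smallness with an explicit budget [c], so that costs add up over unions; [c = 1 / 2] is
    [p_small]. Families are predicates, which lets existential configurations be used directly. *)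
Definition coverable (F : {set V} -> Prop) (c : R) : Prop :=
  exists2 GG : {set {set V}},
    (forall A, F A -> exists2 S, S \in GG & S \subset A) & cost GG <= c.

Lemma costU GG GG' : cost (GG :|: GG') <= cost GG + cost GG'.
Proof.
rewrite /cost (big_setID GG) /= setIUl setIid.
rewrite (setUidPl (subsetIr _ _)) setDUl setDv set0U lerD2l.
rewrite [leRHS](big_setID GG) /= lerDr.
by apply: sumr_ge0 => S _; rewrite exprn_ge0.
Qed.

Lemma coverable_imp (F F' : {set V} -> Prop) c c' :
  (forall A, F A -> F' A) -> c' <= c -> coverable F' c' -> coverable F c.
Proof.
move=> FF' cc' [GG Gcov Gc]; exists GG; last exact: le_trans Gc cc'.
by move=> A /FF' /Gcov.
Qed.

Lemma coverable0 : coverable (fun=> False) 0.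
Proof. by exists set0 => //; rewrite /cost big_set0. Qed.

Lemma coverableU F F' c c' : coverable F c -> coverable F' c' ->
  coverable (fun A => F A \/ F' A) (c + c').
Proof.
move=> [GG Gcov Gc] [GG' Gcov' Gc']; exists (GG :|: GG').
  by move=> A [/Gcov|/Gcov'] [S SG SA]; exists S => //; rewrite inE SG ?orbT.
exact: le_trans (costU _ _) (lerD Gc Gc').
Qed.

Lemma coverable_bigcup n (F : nat -> {set V} -> Prop) (c : nat -> R) :
  (forall i, (i < n)%N -> coverable (F i) (c i)) ->
  coverable (fun A => exists2 i, (i < n)%N & F i A) (\sum_(i < n) c i).
Proof.
elim: n => [_|n IHn Fc].
  by rewrite big_ord0; apply: coverable_imp coverable0 => // A [].
rewrite big_ord_recr /=.
have := coverableU (IHn (fun i lt_in => Fc i (ltnW lt_in))) (Fc n (ltnSn n)).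
apply: coverable_imp => // A [i]; rewrite ltnS leq_eqVlt => /predU1P[-> | ltin].
  by right.
by left; exists i.
Qed.

Lemma coverable_set (F : {set V} -> Prop) (GG : {set {set V}}) c :
  (forall A, F A -> exists2 S, S \in GG & S \subset A) -> cost GG <= c ->
  coverable F c.
Proof. by exists GG. Qed.

Definition packs (H : {set {set V}}) (m : nat) (U : {set V}) : Prop :=
  exists P : {set {set V}},
    [/\ P \subset H, trivIset P, cover P \subset U & (m <= #|P|)%N].

(** From [exp (-1/2) >= 1 - 1/2] follows [exp (1/2) <= 2], which is then squared. *)
Lemma expR1_le4 : sequences.expR 1 <= 4 :> R.
Proof.
have h : sequences.expR (- (1 / 2)) >= 1 / 2 :> R.
  by apply: le_trans (exp.expR_ge1Dx _); lra.
have -> : 1 = 1 / 2 + 1 / 2 :> R by lra.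
rewrite exp.expRD; move: h; rewrite exp.expRN => h.
have e0 : 0 < sequences.expR (1 / 2) :> R by exact: exp.expR_gt0.
suff: sequences.expR (1 / 2) <= 2 :> R by nra.
by rewrite -[leRHS]invrK -lef_pV2 ?posrE ?invr_gt0 // ?invrK; lra.
Qed.

(* The generating function of the disjoint subfamilies of [H], weighted by
   [t] to the number of members, is at most [\prod_(T in H) (1 + t p^#|T|)]. *)
Lemma coverable_packs (H : {set {set V}}) (t : R) (m : nat) :
  1 <= t -> t * cost H <= m%:R -> coverable (packs H m) ((4 / t) ^+ m).
Proof.
move=> t1 tm; have t0 : 0 < t by lra.
pose PP := [set P : {set {set V}} | [&& P \subset H, trivIset P & m <= #|P|]%N].
exists (cover @: PP) => [U [P [PH trP PU mP]]|].
  by exists (cover P) => //; apply/imsetP; exists P; rewrite ?inE ?PH ?trP.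
rewrite /cost.
(* Different packings may have the same union, so summing over packings can only increase the
   cost. *)
have le1 : \sum_(S in cover @: PP) p ^+ #|S| <= \sum_(P in PP) p ^+ #|cover P|.
  rewrite (partition_big_imset (@cover V)) /=; apply: ler_sum => S.
  case/imsetP => P PPP ->; rewrite (bigD1 P) ?PPP ?eqxx //= lerDl.
  by apply: sumr_ge0 => Q _; rewrite exprn_ge0.
apply: le_trans le1 _.
pose F (T : {set V}) : R := if T \in H then t * p ^+ #|T| else 0.
have F0 T : 0 <= F T.
  by rewrite /F; case: ifP => // _; rewrite mulr_ge0 ?exprn_ge0 // ltW.
(* Disjointness turns [p ^+ #|cover P|] into a product over [P], and [1 <= t] gives
   [t ^+ m <= t ^+ #|P|]. *)
have le2 : t ^+ m * \sum_(P in PP) p ^+ #|cover P| <=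
    \sum_(J in {set {set V}}) \prod_T (if T \in J then F T else 1).
  rewrite mulr_sumr [leRHS](bigID (mem PP)) /= -[leLHS]addr0 lerD //; last first.
    by apply: sumr_ge0 => J _; apply: prodr_ge0 => T _; case: ifP.
  apply: ler_sum => P; rewrite inE => /and3P[PH /eqP <- mP].
  have -> : \prod_T (if T \in P then F T else 1) =
      \prod_(T in P) (t * p ^+ #|T|).
    rewrite -big_mkcond /=; apply: eq_bigr => T /(subsetP PH) TH.
    by rewrite /F TH.
  rewrite -prodrXr big_split /= prodr_const.
  apply: ler_wpM2r; first by apply: prodr_ge0 => T _; rewrite exprn_ge0.
  exact: ler_weXn2l.
(* By [1 + x <= exp x], the product is at most [exp (t * cost H) <= exp m <= 4 ^ m]. *)
have le3 : \sum_(J in {set {set V}}) \prod_T (if T \in J then F T else 1)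
    <= 4 ^+ m.
  rewrite -(bigA_distr _ _ F (fun=> 1)).
  apply: (@le_trans _ _ (sequences.expR (t * cost H))).
    rewrite /cost mulr_sumr exp.expR_sum [leRHS]big_mkcond /=.
    apply: ler_prod => T _; rewrite addr_ge0 //= /F; case: ifP => _.
      by rewrite addrC exp.expR_ge1Dx.
    by rewrite add0r.
  apply: (@le_trans _ _ (sequences.expR (m%:R * 1))).
    by rewrite exp.ler_expR mulr1.
  by rewrite exp.expRM_natl lerXn2r ?nnegrE ?exp.expR_ge0 // expR1_le4.
rewrite expr_div_n ler_pdivlMr ?exprn_gt0 // mulrC.
exact: le_trans le2 le3.
Qed.

End Covers.

(** * Splitting a graph into low-degree vertices and disjoint stars *)

Section Decomposition.

Variables (R : realType) (V : finType) (e : rel V) (tau : V -> R).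
Hypotheses (e_sym : symmetric e) (e_irr : irreflexive e).
Hypothesis tau_ge0 : forall v, 0 <= tau v.

Definition nbrs (v : V) : {set V} := [set y | e v y].
Definition deg (A : {set V}) (v : V) : nat := #|A :&: nbrs v|.
(** Pairs are ordered, so each edge inside [A] counts twice. *)
Definition npairs (A : {set V}) : nat := (\sum_(v in A) deg A v)%N.

(** Here [#|T|.-1] is the number of leaves; leaves may be adjacent to one another. *)
Definition star_sets : {set {set V}} :=
  [set T : {set V} | [exists v in T, [&& T :\ v \subset nbrs v,
     (1 < #|T|)%N & tau v <= (#|T|.-1)%:R]]].

Lemma degE A v : deg A v = (\sum_(y in A) e v y)%N.
Proof.
rewrite /deg -sum1_card [RHS]big_mkcond [LHS]big_mkcond /=.
by apply: eq_bigr => y _; rewrite !inE; case: (y \in A); case: (e v y).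
Qed.

Lemma degS (A B : {set V}) v : A \subset B -> (deg A v <= deg B v)%N.
Proof. by move=> AB; apply/subset_leq_card/setSI. Qed.

Lemma degC (A B : {set V}) : (\sum_(x in A) deg B x = \sum_(y in B) deg A y)%N.
Proof.
under eq_bigr do rewrite degE; under [RHS]eq_bigr do rewrite degE.
rewrite exchange_big /=.
by apply: eq_bigr => y _; apply: eq_bigr => x _; rewrite e_sym.
Qed.

(** A lost pair starts or ends in [S]; by symmetry both kinds obey the same bound. *)
Lemma npairs_setD (U S : {set V}) : S \subset U ->
  (npairs U <= npairs (U :\: S) + 2 * \sum_(x in S) deg U x)%N.
Proof.
move=> SU; rewrite {1}/npairs (big_setID S) /= (setIidPr SU) mul2n -addnn.
rewrite addnCA leq_add2l.
have -> : (\sum_(x in U :\: S) deg U x =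
    npairs (U :\: S) + \sum_(x in U :\: S) deg S x)%N.
  rewrite /npairs -big_split /=; apply: eq_bigr => x _.
  rewrite !degE (big_setID S) /= (setIidPr SU) addnC //.
rewrite leq_add2l degC; apply: leq_sum => x _; apply: degS.
exact: subsetDl.
Qed.

(* Peel off, one after the other, vertices of small remaining degree; when none
   is left, remove the closed neighbourhood of a vertex [v] of maximal remaining
   degree [k]: it is a star with [k >= tau v] leaves and at most [k * k.+1]
   edges of the remaining graph touch it. *)
Lemma star_decomposition (U : {set V}) : exists P : {set {set V}},
  [/\ P \subset star_sets, trivIset P, cover P \subset U &
      (npairs U)%:R <= 2 * (\sum_(v in U) tau v)
                       + \sum_(T in P) (2 * (#|T| * #|T|.-1))%:R].
Proof.
have [n] := ubnP #|U|; elim: n => // n IHn in U *; rewrite ltnS => leUn.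
have [->|[u uU]] := set_0Vmem U.
  exists set0; rewrite sub0set /trivIset /cover !big_set0 sub0set cards0 /=.
  by rewrite /npairs big_set0 mulr0 addr0; split.
have [v /andP[/= vU degv]|no_small] := pickP [pred v in U | (deg U v)%:R <= tau v].
  have vU' : [set v] \subset U by rewrite sub1set.
  have [|P [PH trP PU leP]] := IHn (U :\ v).
    by move: leUn; rewrite (cardsD1 v U) vU.
  exists P; split=> //; first exact: subset_trans PU (subsetDl _ _).
  have := npairs_setD vU'; rewrite big_set1 -(ler_nat R) natrD => le1.
  rewrite (big_setD1 v) //= mulrDr -addrA addrC; apply: le_trans le1 _.
  rewrite lerD // natrM; lra.
pose v := [arg max_(x > u in U) deg U x].
have [vU vmax] : v \in U /\ forall x, x \in U -> (deg U x <= deg U v)%N.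
  by rewrite /v; case: arg_maxnP.
have vtau : tau v < (deg U v)%:R.
  by move: (no_small v); rewrite /= vU /= leNgt => /negbFE.
have k0 : (0 < deg U v)%N by rewrite -(ltr_nat R); apply: le_lt_trans vtau.
pose T := v |: (U :&: nbrs v).
have vN : v \notin U :&: nbrs v by rewrite !inE e_irr andbF.
have cT : #|T| = (deg U v).+1 by rewrite cardsU1 vN.
have TU : T \subset U by rewrite subUset sub1set vU subsetIl.
have [|P [PH trP PU leP]] := IHn (U :\: T).
  apply: leq_trans leUn; apply: proper_card;
  apply/properP; split; first exact: subsetDl.
  by exists v => //; rewrite !inE eqxx.
have Tdis : {in P, forall B : {set V}, [disjoint T & B]}.
  move=> B BP; rewrite disjoint_sym disjoints_subset.
  apply: subset_trans (subset_trans (bigcup_sup B BP) PU) _.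
  by rewrite setDE subsetIr.
(* A star contains its centre; nonemptiness is what lets [trivIsetU1] also give [T \notin P]. *)
have P0 : set0 \notin P.
  apply/negP => /(subsetP PH); rewrite inE => /existsP[x].
  by rewrite inE.
have [trTP TP] := trivIsetU1 Tdis trP P0.
exists (T |: P); split=> //.
- rewrite subUset sub1set PH andbT inE; apply/existsP; exists v.
  rewrite cT /= ltnS k0 (ltW vtau) !andbT !inE eqxx /= setU1K //.
  exact: subsetIr.
- rewrite /cover big_setU1 //= subUset TU.
  exact: subset_trans PU (subsetDl _ _).
have := npairs_setD TU.
have : (\sum_(x in T) deg U x <= #|T| * #|T|.-1)%N.
  rewrite -sum_nat_const; apply: leq_sum => x xT; rewrite cT /=.
  by apply: vmax; apply: (subsetP TU).
rewrite (big_setU1 _ TP) /= -!(ler_nat R) !(natrD, natrM) => le1 le2.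
have := ler_wpM2l (ler0n R 2) le1.
have : \sum_(x in U :\: T) tau x <= \sum_(x in U) tau x.
  rewrite [leRHS](big_setID T) /= lerDr; apply: sumr_ge0 => *.
  exact: tau_ge0.
lra.
Qed.

End Decomposition.

(** * Elementary estimates: geometric sums, factorials, binomials *)

Lemma geometric_sum_le (R : realType) (x : R) n : 0 <= x < 1 ->
  \sum_(k < n) x ^+ k <= (1 - x)^-1.
Proof.
case/andP=> x0 x1; have d0 : 0 < 1 - x by lra.
rewrite -[leRHS]mul1r ler_pdivlMr //.
have := subrX1 x n; have := exprn_ge0 n x0; set S := \sum_(i < n) _; lra.
Qed.

Lemma ffact_le_exp n m : (n ^_ m <= n ^ m)%N.
Proof.
elim: m => [|m IHm]; first by rewrite ffactn0.
by rewrite ffactnSr expnSr leq_mul // leq_subr.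
Qed.

(** The quotient [s ^ s / s!] is a single term of the series of [exp s]. *)
Lemma expn_self_le (R : realType) (s : nat) : s%:R ^+ s <= 4 ^+ s * s`!%:R :> R.
Proof.
case: s => [|s]; first by rewrite !expr0 fact0 mulr1.
rewrite -ler_pdivrMr ?ltr0n ?fact_gt0 //.
apply: (@le_trans _ _ (sequences.expR (s.+1%:R * 1))).
  rewrite mulr1; apply: le_trans (exp.expR_ge1Dxn s (ler0n R s.+1)).
  by rewrite lerDr.
by rewrite exp.expRM_natl lerXn2r ?nnegrE ?exp.expR_ge0 // expR1_le4.
Qed.

(** In [(p d)^(k+1) / (k+1)!] one factor [p d] is kept, so that the bound stays linear in the
    degree; the other [k] are at most [(k+1) / 2048] each. The previous lemma loses a factor 4 per
    power, whence [512 = 2048 / 4]. *)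
Lemma bin_expr_le (R : realType) (p : R) (d k : nat) : 0 <= p ->
  2048 * p * d%:R <= k.+1%:R ->
  'C(d, k.+1)%:R * p ^+ k.+1 <= 4 * (p * d%:R) / 512 ^+ k.
Proof.
move=> p0 pd; have pd0 : 0 <= p * d%:R by rewrite mulr_ge0.
have f0 : 0 < (k.+1)`!%:R :> R by rewrite ltr0n fact_gt0.
have le1 : 'C(d, k.+1)%:R * p ^+ k.+1 * (k.+1)`!%:R <= (p * d%:R) ^+ k.+1.
  rewrite mulrAC -natrM bin_ffact exprMn mulrC ler_wpM2l ?exprn_ge0 //.
  by rewrite -natrX ler_nat ffact_le_exp.
have le2 : (2048 * (p * d%:R)) ^+ k <= 4 ^+ k.+1 * (k.+1)`!%:R.
  apply: le_trans (expn_self_le R k.+1).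
  apply: (@le_trans _ _ (k.+1%:R ^+ k)).
    by rewrite lerXn2r ?nnegrE ?mulr_ge0 // mulrA.
  by apply: ler_weXn2l; rewrite ?ler1n.
rewrite -(ler_pM2r f0); apply: le_trans le1 _.
rewrite exprS; set y := p * d%:R in pd0 le2 *; set f := _%:R in f0 le2 *.
have -> : 4 * y / 512 ^+ k * f = y * (4 * f / 512 ^+ k) by rewrite -!mulrA; ring.
rewrite ler_wpM2l // ler_pdivlMr ?exprn_gt0 //.
rewrite -(ler_pM2l (exprn_gt0 k (ltr0n R 4))) mulrA -!exprMn.
move: le2; rewrite exprSr -mulrA; congr (_ <= _).
by congr (_ ^+ _); ring.
Qed.

(** * Cheap covers for packings of stars *)

Section StarCovers.

Variables (R : realType) (V : finType) (e : rel V) (p : R).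
Hypotheses (e_sym : symmetric e) (e_irr : irreflexive e) (p_ge0 : 0 <= p).

Definition scaled_deg (v : V) : R := 2048 * p * #|nbrs e v|%:R.

(** The offset makes [k.+1] the number of leaves. *)
Definition stars (k : nat) : {set {set V}} :=
  [set T in star_sets e scaled_deg | #|T| == k.+2].

(** For a probability [p], the expected number of ordered adjacent pairs inside a [p]-random vertex
    set. *)
Definition mean_pairs : R := p ^+ 2 * \sum_v #|nbrs e v|%:R.

(* The summand [i %/ k.+1] makes the covers summable over [i] at a price, cubic
   in [i], that the weight [16^-i] of the [i]-th class absorbs. *)
Definition max_stars (i k : nat) : nat :=
  (Num.truncn (256 * mean_pairs / 8 ^+ k) + i %/ k.+1)%N.

Lemma mean_pairs_ge0 : 0 <= mean_pairs.
Proof. by rewrite mulr_ge0 ?exprn_ge0 // sumr_ge0. Qed.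

(** A star is determined by its centre and its leaves, and only centres of small enough degree are
    allowed. *)
Lemma card_stars k :
  (#|stars k| <= \sum_(v | (scaled_deg v <= k.+1%:R)%R) 'C(#|nbrs e v|, k.+1))%N.
Proof.
pose draws v := [set S : {set V} | S \subset nbrs e v & #|S| == k.+1].
pose B := \bigcup_(v | scaled_deg v <= k.+1%:R) [set v |: S | S in draws v].
have sB : stars k \subset B.
  apply/subsetP => T; rewrite !inE => /andP[/existsP[v]].
  case/and4P=> vT Tv _ + /eqP cT; rewrite cT /= => le_v.
  apply/bigcupP; exists v => //; apply/imsetP; exists (T :\ v).
    by rewrite inE Tv /=; have := cardsD1 v T; rewrite vT cT add1n => -[<-].
  by rewrite setD1K.
apply: leq_trans (subset_leq_card sB) _; rewrite /B.
elim/big_rec2: _ => [|v n A _ le_An]; first by rewrite cards0.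
rewrite cardsU; apply: leq_trans (leq_subr _ _) _; apply: leq_add => //.
apply: leq_trans (leq_imset_card _ _) _.
by rewrite cards_draws.
Qed.

Lemma cost_stars k : cost p (stars k) <= 4 * mean_pairs / 512 ^+ k.
Proof.
rewrite /cost (eq_bigr (fun=> p ^+ k.+2)); last first.
  by move=> T; rewrite inE => /andP[_ /eqP ->].
rewrite sumr_const -[leLHS]mulr_natl.
have : (#|stars k|%:R : R) <=
    (\sum_(v | (scaled_deg v <= k.+1%:R)%R) 'C(#|nbrs e v|, k.+1))%N%:R.
  by rewrite ler_nat card_stars.
move/(ler_wpM2r (exprn_ge0 k.+2 p_ge0))=> le1; apply: le_trans le1 _.
rewrite natr_sum mulr_suml.
apply: (@le_trans _ _ (\sum_(v | scaled_deg v <= k.+1%:R)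
    4 * p ^+ 2 * #|nbrs e v|%:R / 512 ^+ k)).
  apply: ler_sum => v le_v; rewrite exprSr mulrA.
  have := ler_wpM2r p_ge0 (bin_expr_le p_ge0 le_v).
  by rewrite (_ : 4 * (p * _) / _ * p = 4 * p ^+ 2 * #|nbrs e v|%:R / 512 ^+ k)
    //; ring.
rewrite /mean_pairs mulrA mulr_sumr mulr_suml.
rewrite [leRHS](bigID (fun v => scaled_deg v <= k.+1%:R)) /= lerDl.
apply: sumr_ge0 => v _.
by rewrite !(mulr_ge0, exprn_ge0, invr_ge0).
Qed.

(** The packing bound is used with [t = 64 ^ k.+1]: then [t] times the cost is at most
    [256 * mean_pairs / 8 ^ k], the quantity truncated in [max_stars]. *)
Lemma coverable_stars i k :
  coverable p (packs (stars k) (max_stars i k).+1) (4^-1 ^+ (i.+1 + k.+1)).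
Proof.
set M := (max_stars i k).+1.
have t1 : (1 : R) <= 64 ^+ k.+1 by apply: exprn_ege1; lra.
have tM : 64 ^+ k.+1 * cost p (stars k) <= M%:R.
  apply: (@le_trans _ _ (256 * mean_pairs / 8 ^+ k)).
    apply: (@le_trans _ _ (64 ^+ k.+1 * (4 * mean_pairs / 512 ^+ k))).
      by rewrite ler_wpM2l ?cost_stars // exprn_ge0.
    rewrite (_ : 512 = 64 * 8) ?exprMn; last by ring.
    have h64 : (64 ^+ k : R) != 0 by rewrite expf_neq0 //; lra.
    have h8 : (8 ^+ k : R) != 0 by rewrite expf_neq0 //; lra.
    by rewrite exprS le_eqVlt; apply/orP; left; apply/eqP; field; apply/andP.
  apply: le_trans (ltW (truncnS_gt _)) _.
  by rewrite ler_nat ltnS leq_addr.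
apply: coverable_imp (coverable_packs p_ge0 t1 tM) => //.
(* Since [k.+1 * M] is at least [i.+1] and at least [k.+1], its double pays for both exponents. *)
have sM : (i + k.+2 <= 2 * (k.+1 * M))%N.
  have lt_i : (i < k.+1 * (i %/ k.+1).+1)%N by rewrite mulnC ltn_ceil.
  have leM : ((i %/ k.+1).+1 <= M)%N by rewrite ltnS leq_addl.
  have := leq_mul (leqnn k.+1) leM; have : (k.+1 * 1 <= k.+1 * M)%N.
    by rewrite leq_mul.
  by lia.
apply: (@le_trans _ _ ((16^-1 ^+ k.+1) ^+ M)).
  apply: lerXn2r; rewrite ?nnegrE ?divr_ge0 ?exprn_ge0 ?invr_ge0 //.
  rewrite ler_pdivrMr ?exprn_gt0 // -exprMn (_ : 16^-1 * 64 = 4); last by field.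
  by rewrite exprS ler_peMr ?exprn_ege1 //; lra.
rewrite -exprM (_ : 16^-1 = 4^-1 ^+ 2 :> R) -?exprM; last by field.
apply: ler_wiXn2l; [lra | lra | by lia].
Qed.

(** The stars of the decomposition are grouped by size. The truncated part of [max_stars] sums
    geometrically to the [mean_pairs] term, the quotient part to the cubic term. *)
Lemma npairs_le i (U : {set V}) :
  (forall k, (k < #|V|)%N -> ~ packs (stars k) (max_stars i k).+1 U) ->
  (npairs e U)%:R <=
    2 * (\sum_(v in U) scaled_deg v) + 2048 * mean_pairs + (4 * i ^ 3)%:R.
Proof.
move=> noP.
have sd0 v : 0 <= scaled_deg v by rewrite !mulr_ge0.
have [P [PH trP PU leP]] := star_decomposition e_sym e_irr sd0 U.
apply: le_trans leP _; rewrite -addrA lerD2l.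
have cardP k : (k < #|V|)%N ->
    (\sum_(T in P) (#|T| == k.+2) <= max_stars i k)%N.
  move=> lt_kV; rewrite leqNgt; apply/negP => ltM; case: (noP k lt_kV).
  exists [set T in P | #|T| == k.+2]; split.
  - apply/subsetP => T; rewrite !inE => /andP[/(subsetP PH)].
    by rewrite inE => -> ->.
  - by apply: trivIsetS trP; apply/subsetP => T; rewrite inE => /andP[].
  - apply: subset_trans PU; rewrite /cover; apply/bigcupsP => T.
    by rewrite inE => /andP[TP _]; exact: (bigcup_sup T).
  - move: ltM; rewrite -sum1_card [X in (_ <= X -> _)%N]big_mkcond /=.
    rewrite [X in (_ -> _ <= X)%N]big_mkcond /=.
    congr (_ <= _)%N; apply: eq_bigr => T _; rewrite inE.
    by case: (T \in P); case: eqP.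
have splitP : (\sum_(T in P) (2 * (#|T| * #|T|.-1)) =
    \sum_(k < #|V|) (2 * (k.+2 * k.+1)) * (\sum_(T in P) (#|T| == k.+2)))%N.
  under [RHS]eq_bigr do rewrite big_distrr /=.
  rewrite exchange_big /=; apply: eq_bigr => T /(subsetP PH).
  rewrite inE => /existsP[v /and4P[_ _ cT _]].
  case cTE: #|T| cT => [|[|k]] // _.
  have lt_kV : (k < #|V|)%N.
    by apply: leq_trans (max_card (mem T)); rewrite cTE ltnW.
  rewrite (bigD1 (Ordinal lt_kV)) //= eqxx muln1 big1 ?addn0 // => j.
  rewrite -val_eqE /= eqSS eqSS eq_sym => /negbTE ->.
  by rewrite muln0.
rewrite -natr_sum splitP.
have le1 : (\sum_(k < #|V|) (2 * (k.+2 * k.+1)) *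
      (\sum_(T in P) (#|T| == k.+2)) <=
    \sum_(k < #|V|) 4 * (k.+1 ^ 2 * Num.truncn (256 * mean_pairs / 8 ^+ k)%R)
    + \sum_(k < #|V|) 4 * ((k < i) * i ^ 2))%N.
  rewrite -big_split /=; apply: leq_sum => k _.
  have := cardP k (ltn_ord k); rewrite /max_stars.
  set x := (\sum_(T in P) _)%N; set y := Num.truncn _ => le_x.
  (* The quotient vanishes for [i <= k]; otherwise [k.+1] times it is at most [i]. *)
  have le_i : ((k.+1) ^ 2 * (i %/ k.+1) <= (k < i) * i ^ 2)%N.
    have [lt_ki|le_ik] := ltnP k i; last by rewrite divn_small ?muln0.
    rewrite mul1n -!mulnn -mulnA leq_mul // mulnC; exact: leq_trunc_div.
  by move: le_x le_i; set z := (i %/ _)%N; rewrite -!mulnn; nia.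
apply: (@le_trans _ _ (\sum_(k < #|V|) (1024 * mean_pairs * 2^-1 ^+ k) +
    (\sum_(k < #|V|) (4 * ((k < i) * i ^ 2)))%:R)).
  move: le1; rewrite -(ler_nat R) natrD => le1.
  apply: le_trans le1 _; apply: lerD => //; rewrite natr_sum; apply: ler_sum => k _.
  set x := 256 * mean_pairs / 8 ^+ k.
  have x0 : 0 <= x.
    apply: divr_ge0; last exact: exprn_ge0.
    by apply: mulr_ge0 => //; apply: mean_pairs_ge0.
  have : (Num.truncn x)%:R <= x by rewrite truncn_le.
  (* This is the square of [k.+1 <= 2 ^ k]; against [8 ^ k] it leaves the ratio [1/2]. *)
  have : ((k.+1) ^ 2)%:R <= 4 ^+ k :> R.
    by rewrite -natrX ler_nat (_ : 4 = 2 ^ 2)%N // expnAC leq_exp2r // ltn_expl.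
  move=> le_k le_x.
  have -> : 1024 * mean_pairs * 2^-1 ^+ k = 4 * (4 ^+ k * x).
    have h8 : 8 ^+ k = 4 ^+ k * 2 ^+ k :> R.
      by rewrite -exprMn; congr (_ ^+ _); ring.
    have h4 : (4 ^+ k : R) != 0 by rewrite expf_neq0 // pnatr_eq0.
    have h2 : (2 ^+ k : R) != 0 by rewrite expf_neq0 // pnatr_eq0.
    by rewrite /x h8 exprVn; field; apply/andP.
  by rewrite natrM ler_wpM2l // natrM; apply: ler_pM.
rewrite lerD //.
  rewrite -mulr_sumr (_ : 2048 * mean_pairs = 1024 * mean_pairs * 2); last by ring.
  apply: ler_wpM2l; first by apply: mulr_ge0 => //; apply: mean_pairs_ge0.
  have := @geometric_sum_le R 2^-1 #|V|; rewrite (_ : (1 - 2^-1)^-1 = 2); last by field.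
  by apply; lra.
rewrite ler_nat -big_distrr leq_mul2l /= -big_distrl /= expnS leq_mul2r.
apply/orP; right.
suff -> : (\sum_(k < #|V|) (k < i) = minn #|V| i)%N by exact: geq_minr.
elim: #|V| => [|m IHm]; first by rewrite big_ord0 min0n.
by rewrite big_ord_recr /= IHm; lia.
Qed.

End StarCovers.

(** * Geometric weight classes *)

Section Levels.

Variables (R : realType) (kappa : R).
Hypothesis kappa_gt0 : 0 < kappa.

Definition level (i : nat) (r : R) : bool :=
  (kappa / 16 ^+ i.+1 < r) && (r <= kappa / 16 ^+ i).

Lemma level_exists r : 0 < r <= kappa -> exists i, level i r.
Proof.
case/andP=> r0 rk.
have ex : exists n, kappa / 16 ^+ n < r.
  exists (Num.Def.archi_bound (kappa / r)).
  rewrite ltr_pdivrMr ?exprn_gt0 // -ltr_pdivrMl // mulrC.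
  have := archi_boundP (divr_ge0 (ltW kappa_gt0) (ltW r0)).
  by move/lt_le_trans; apply; rewrite -natrX ler_nat ltnW // ltn_expl.
case: (ex_minnP ex) => [[|m]].
  by rewrite expr0 divr1 ltNge rk.
move=> lt_r min; exists m; rewrite /level lt_r /= leNgt.
by apply/negP => /min; rewrite ltnn.
Qed.

Lemma level_inj i j r : level i r -> level j r -> i = j.
Proof.
wlog lt_ij : i j / (i < j)%N => [IH li lj|].
  by have [/IH->|/IH <-|] := ltngtP i j.
case/andP=> lt_r _ /andP[_ le_r].
have := lt_le_trans lt_r le_r; rewrite ltr_pM2l // ltf_pV2 ?posrE ?exprn_gt0 //.
by rewrite ltNge ler_weXn2l // ler1n.
Qed.

(** A single bound [N] for all values keeps the sums over classes finite. *)
Lemma finite_levels (T : finType) (f : T -> R) : exists N, forall x,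
  0 < f x <= kappa -> exists2 i, (i < N)%N & level i (f x).
Proof.
have : forall x, exists i, 0 < f x <= kappa -> level i (f x).
  move=> x; case fx: (0 < f x <= kappa); last by exists 0%N.
  by have [i li] := level_exists fx; exists i.
move/fin_all_exists => [g gP]; exists (\max_x g x).+1 => x /gP lx.
by exists (g x) => //; rewrite ltnS leq_bigmax.
Qed.

(** At most one term is nonzero, and rounding up to the top of a class costs a factor at most 16. *)
Lemma level_sum_le N r : 0 <= r ->
  \sum_(i < N) (level i r)%:R * (kappa / 16 ^+ i) <= 16 * r.
Proof.
move=> r0.
have [i li|no] := pickP [pred i : 'I_N | level i r]; last first.
  rewrite big1 ?mulr_ge0 // => i _.
  by have /= -> := no i; rewrite mul0r.
rewrite (bigD1 i) //= [level i r]li mul1r big1 ?addr0; last first.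
  move=> j ji; case lj: (level j r); last by rewrite mul0r.
  by case/eqP: ji; apply/val_inj; apply: (level_inj lj li).
case/andP: li; rewrite exprS => /ltW + _.
by rewrite invfM mulrCA ler_pdivrMl.
Qed.

Lemma level_sum_ge N r : 0 <= r <= kappa ->
  (0 < r <= kappa -> exists2 i, (i < N)%N & level i r) ->
  r <= \sum_(i < N) (level i r)%:R * (kappa / 16 ^+ i).
Proof.
have t0 s (i : 'I_N) : 0 <= (level i s)%:R * (kappa / 16 ^+ i).
  by rewrite mulr_ge0 // divr_ge0 ?exprn_ge0 // ltW.
case/andP; rewrite le_eqVlt => /predU1P[<- _ _|r0 rk].
  by apply: sumr_ge0.
case; first by rewrite r0.
move=> i ltiN li; rewrite (bigD1 (Ordinal ltiN)) //= li mul1r.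
case/andP: li => _ /le_trans; apply; rewrite lerDl.
by apply: sumr_ge0.
Qed.

(** From [i <= 2 ^ i] follows [i ^ 3 <= 8 ^ i], leaving a geometric series of ratio [1/2]. *)
Lemma cube_sum_le N : \sum_(i < N) kappa / 16 ^+ i * (i ^ 3)%:R <= 2 * kappa.
Proof.
apply: (@le_trans _ _ (kappa * \sum_(i < N) 2^-1 ^+ i)).
  rewrite mulr_sumr; apply: ler_sum => i _; rewrite -mulrA ler_pM2l //.
  rewrite ler_pdivrMl ?exprn_gt0 // exprVn ler_pdivlMr ?exprn_gt0 //.
  rewrite -!natrX -natrM ler_nat (_ : 16 = 8 * 2)%N // expnMn leq_mul2r.
  by rewrite (_ : 8 = 2 ^ 3)%N // expnAC leq_exp2r // ltnW ?orbT // ltn_expl.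
have := @geometric_sum_le R 2^-1 N.
rewrite (_ : (1 - 2^-1)^-1 = 2); last by field.
by move=> h; rewrite mulrC ler_pM2r //; apply: h; lra.
Qed.

End Levels.

(** * Weights on points *)

Section VertexWeights.

Variables (R : realType) (V : finType) (p : R) (d : V -> R).
Hypotheses (p_gt0 : 0 < p) (d_ge0 : forall v, 0 <= d v).
Hypothesis d_gt0 : 0 < \sum_v d v.

Lemma coverable_weight :
  coverable p (fun U => 1056 * p * (\sum_v d v) < \sum_(v in U) d v) (1 / 7).
Proof.
set D := \sum_v d v; have p0 := ltW p_gt0.
pose kappa := 16 * p * D.
have kappa0 : 0 < kappa by rewrite !mulr_gt0.
have [N Nlev] := finite_levels kappa0 d.
pose lev i := [set v | level kappa i (d v)].
(* The summand [i] brings the cost of packing more than [M i] points down to [16^-(i+1)]. *)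
pose M i := (Num.truncn (64 * (p * #|lev i|%:R)) + i)%N.
pose singles i := [set [set v] | v in lev i].
(* Markov's inequality: each heavy point costs [p <= p * (d v / kappa)]. *)
have heavy : coverable p (fun U => exists2 v, v \in U & kappa < d v) (1 / 16).
  apply: (@coverable_set _ _ _ _ [set [set v] | v in [set v | kappa < d v]]).
    move=> U [v vU dv]; exists [set v]; rewrite ?sub1set //.
    by apply/imsetP; exists v; rewrite ?inE.
  rewrite /cost big_imset /=; last by move=> x y _ _ /set1_inj.
  apply: (@le_trans _ _ (\sum_v p * (d v / kappa))).
    rewrite [leLHS]big_mkcond; apply: ler_sum => v _; rewrite inE cards1 expr1.
    case: ifP => [dv|_]; last by rewrite mulr_ge0 // divr_ge0 // ltW.
    by rewrite ler_peMr // ler_pdivlMr // mul1r ltW.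
  rewrite -mulr_sumr -mulr_suml -/D /kappa le_eqVlt; apply/orP; left; apply/eqP.
  by field; rewrite !gt_eqF.
have packs_i i : (i < N)%N -> coverable p (packs (singles i) (M i).+1) (16^-1 ^+ i.+1).
  move=> _; have t1 : (1 : R) <= 64 by lra.
  have cM : 64 * cost p (singles i) <= (M i).+1%:R.
    rewrite /cost big_imset /=; last by move=> x y _ _ /set1_inj.
    rewrite (eq_bigr (fun=> p)); last by move=> v _; rewrite cards1 expr1.
    rewrite sumr_const -[p *+ _]mulr_natr; apply: le_trans (ltW (truncnS_gt _)) _.
    by rewrite ler_nat ltnS /M leq_addr.
  apply: coverable_imp (coverable_packs p0 t1 cM) => //.
  rewrite (_ : 4 / 64 = 16^-1); last by field.
  by apply: ler_wiXn2l; [lra | lra | rewrite ltnS /M leq_addl].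
have cov := coverableU p0 heavy (coverable_bigcup p0 packs_i).
(* The budget is [1/16 + 1/15 <= 1/7]. *)
apply: coverable_imp cov; last first.
  under eq_bigr do rewrite exprS.
  rewrite -mulr_sumr.
  have := @geometric_sum_le R 16^-1 N.
  rewrite (_ : (1 - 16^-1)^-1 = 16 / 15); last by field.
  by set S := \sum_(i < N) _ => h; have {h} : S <= 16 / 15; [apply: h|]; lra.
move=> U lt_U; apply: boolp.contrapT => noU.
have le_k v : v \in U -> d v <= kappa.
  by move=> vU; rewrite leNgt; apply/negP => dv; apply: noU; left; exists v.
have card_i (i : 'I_N) : (#|U :&: lev i| <= M i)%N.
  rewrite leqNgt; apply/negP => ltM; apply: noU; right; exists i => //.
  exists [set [set v] | v in U :&: lev i]; split.
  - by apply: imsetS; apply: subsetIr.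
  - apply/trivIsetP => _ _ /imsetP[x _ ->] /imsetP[y _ ->] xy.
    by rewrite disjoints1 inE; apply: contra xy => /eqP ->.
  - by rewrite cover_imset; apply/bigcupsP => v; rewrite inE sub1set => /andP[].
  - by rewrite card_imset //; apply: set1_inj.
have k0 (i : 'I_N) : 0 <= kappa / 16 ^+ i.
  by rewrite divr_ge0 ?exprn_ge0 // ltW.
have : \sum_(v in U) d v <=
    \sum_(i < N) kappa / 16 ^+ i * (64 * (p * #|lev i|%:R) + (i ^ 3)%:R).
  apply: (@le_trans _ _ (\sum_(v in U) \sum_(i < N)
      (level kappa i (d v))%:R * (kappa / 16 ^+ i))).
    apply: ler_sum => v vU; apply: level_sum_ge => //; last exact: Nlev.
    by rewrite d_ge0 le_k.
  rewrite exchange_big /=; apply: ler_sum => i _.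
  rewrite -mulr_suml mulrC ler_wpM2l //.
  have -> : \sum_(v in U) (level kappa i (d v))%:R = #|U :&: lev i|%:R :> R.
    rewrite -natr_sum -sum1_card; congr (_%:R).
    rewrite big_mkcond [RHS]big_mkcond; apply: eq_bigr => v _.
    by rewrite !inE; case: (v \in U); case: level.
  apply: (@le_trans _ _ (M i)%:R); first by rewrite ler_nat.
  rewrite natrD lerD ?truncn_le ?ler_nat ?mulr_ge0 //.
  by case: (nat_of_ord i) => // n; rewrite -{1}(expn1 n.+1) leq_pexp2l.
rewrite leNgt => /negP; apply; apply: le_lt_trans lt_U.
(* The two sums give [1024 p D] and [2 kappa = 32 p D], whence 1056. *)
under eq_bigr do rewrite mulrDr.
rewrite big_split /=; apply: (@le_trans _ _ (64 * p * (16 * D) + 2 * kappa)).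
  apply: lerD; last exact: cube_sum_le.
  rewrite (eq_bigr (fun i : 'I_N => 64 * p *
      \sum_v (level kappa i (d v))%:R * (kappa / 16 ^+ i))); last first.
    move=> i _; rewrite -mulr_suml.
    have -> : \sum_v (level kappa i (d v))%:R = #|lev i|%:R :> R.
      rewrite -natr_sum -sum1_card big_mkcond [X in _ = X%:R]big_mkcond.
      by congr (_%:R); apply: eq_bigr => v _; rewrite inE; case: level.
    by rewrite -!mulrA; ring.
  rewrite -mulr_sumr exchange_big /= ler_wpM2l ?mulr_ge0 //.
  by rewrite /D mulr_sumr; apply: ler_sum => v _; apply: level_sum_le.
by rewrite /kappa; lra.
Qed.

End VertexWeights.

(** * Symmetric weights on ordered pairs *)

Section PairWeights.

Variables (R : realType) (V : finType) (p : R) (w : V -> V -> R).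
Hypotheses (p_gt0 : 0 < p) (w_ge0 : forall x y, 0 <= w x y).
Hypotheses (w_sym : forall x y, w x y = w y x) (w_diag : forall x, w x x = 0).

Let D := \sum_x \sum_y w x y.
Hypothesis D_gt0 : 0 < D.

Lemma coverable_pair_weight :
  coverable p (fun U => 2 ^+ 27 * p ^+ 2 * D
                          < \sum_(x in U) \sum_(y in U) w x y) (1 / 2).
Proof.
have p0 := ltW p_gt0.
pose kappa := 16 * p ^+ 2 * D.
have kappa0 : 0 < kappa by rewrite !mulr_gt0 ?exprn_gt0.
have [N Nlev] := finite_levels kappa0 (fun u : V * V => w u.1 u.2).
pose e i : rel V := fun x y => level kappa i (w x y).
have e_sym i : symmetric (e i) by move=> x y; rewrite /e w_sym.
have e_irr i : irreflexive (e i).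
  move=> x; rewrite /e w_diag /level ltNge divr_ge0 ?exprn_ge0 //.
  exact: ltW.
pose d x := \sum_y w x y.
have d_ge0 x : 0 <= d x by apply: sumr_ge0.
have heavy : coverable p
    (fun U => exists x y, [/\ x \in U, y \in U & kappa < w x y]) (1 / 16).
  apply: (@coverable_set _ _ _ _
      [set [set u.1; u.2] | u in [set u : V * V | kappa < w u.1 u.2]]).
    move=> U [x [y [xU yU dv]]]; exists [set x; y].
      by apply/imsetP; exists (x, y); rewrite ?inE.
    by rewrite subUset !sub1set xU.
  rewrite /cost.
  apply: (@le_trans _ _ (\sum_(u : V * V) p ^+ 2 * (w u.1 u.2 / kappa))).
    apply: (@le_trans _ _ (\sum_(u in [set u : V * V | kappa < w u.1 u.2])
        p ^+ #|[set u.1; u.2]|)).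
      rewrite [leRHS](partition_big_imset (fun u => [set u.1; u.2])) /=.
      apply: ler_sum => S /imsetP[u uw ->].
      rewrite (bigD1 u) ?uw ?eqxx //= lerDl.
      by apply: sumr_ge0 => v _; rewrite exprn_ge0.
    rewrite [leLHS]big_mkcond; apply: ler_sum => u _; rewrite inE.
    case: ifP => [dv|_]; last by rewrite mulr_ge0 ?exprn_ge0 // divr_ge0 // ltW.
    (* The zero diagonal ensures that a heavy pair has two distinct endpoints, hence cost
       [p ^+ 2]. *)
    have ne : u.1 != u.2.
      apply: contraTneq dv => ->; rewrite w_diag -leNgt; exact: ltW.
    by rewrite cards2 ne ler_peMr ?exprn_ge0 // ler_pdivlMr // mul1r ltW.
  rewrite -mulr_sumr -mulr_suml -(pair_bigA _ w) /= -/D /kappa.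
  rewrite le_eqVlt; apply/orP; left; apply/eqP.
  by field; rewrite !gt_eqF.
have light := coverable_weight p_gt0 d_ge0 D_gt0.
have stars_i i : (i < N)%N -> coverable p
    (fun U => exists2 k, (k < #|V|)%N &
       packs (stars (e i) p k) (max_stars (e i) p i k).+1 U)
    (\sum_(k < #|V|) 4^-1 ^+ (i.+1 + k.+1)).
  move=> _; apply: (coverable_bigcup p0 (c := fun k => 4^-1 ^+ (i.+1 + k.+1))
    (F := fun k => packs (stars (e i) p k) (max_stars (e i) p i k).+1)) => k _.
  exact: coverable_stars.
have cov := coverableU p0 heavy (coverableU p0 light (coverable_bigcup p0 stars_i)).
(* The budget is [1/16 + 1/7 + 1/9 <= 1/2]. *)
apply: coverable_imp cov; last first.
  have gsum n : \sum_(i < n) 4^-1 ^+ i.+1 <= 1 / 3 :> R.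
    under eq_bigr do rewrite exprS.
    rewrite -mulr_sumr.
    have := @geometric_sum_le R 4^-1 n.
    rewrite (_ : (1 - 4^-1)^-1 = 4 / 3); last by field.
    by set S := \sum_(i < n) _ => h; have {h} : S <= 4 / 3; [apply: h|]; lra.
  have le9 : \sum_(i < N) \sum_(k < #|V|) 4^-1 ^+ (i.+1 + k.+1) <= 1 / 9 :> R.
    rewrite (eq_bigr (fun i : 'I_N =>
        4^-1 ^+ i.+1 * \sum_(k < #|V|) 4^-1 ^+ k.+1)); last first.
      by move=> i _; rewrite mulr_sumr; apply: eq_bigr => k _; rewrite exprD.
    rewrite -mulr_suml (_ : 1 / 9 = 1 / 3 * (1 / 3)); last by field.
    apply: ler_pM; rewrite ?gsum //; apply: sumr_ge0 => i _;
      by rewrite exprn_ge0 ?invr_ge0.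
  by move: le9; lra.
move=> U lt_U; apply: boolp.contrapT => noU.
have le_k x y : x \in U -> y \in U -> w x y <= kappa.
  move=> xU yU; rewrite leNgt; apply/negP => wxy.
  by apply: noU; left; exists x, y.
have le_d : \sum_(x in U) d x <= 1056 * p * D.
  by rewrite leNgt; apply/negP => ltd; apply: noU; right; left.
have npairs_i (i : 'I_N) : (npairs (e i) U)%:R <=
    2 * (\sum_(v in U) scaled_deg (e i) p v) + 2048 * mean_pairs (e i) p
      + (4 * i ^ 3)%:R.
  apply: npairs_le => // k ltk Pk; apply: noU; right; right.
  by exists i => //; exists k.
have k0 (i : 'I_N) : 0 <= kappa / 16 ^+ i.
  by rewrite divr_ge0 ?exprn_ge0 // ltW.
have nbrsE (i : 'I_N) x : #|nbrs (e i) x|%:R =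
    \sum_y (level kappa i (w x y))%:R :> R.
  rewrite -natr_sum -sum1_card big_mkcond [X in _ = X%:R]big_mkcond.
  by congr (_%:R); apply: eq_bigr => y _; rewrite inE /e; case: level.
have sum_nbrs x : \sum_(i < N) kappa / 16 ^+ i * #|nbrs (e i) x|%:R <= 16 * d x.
  rewrite /d mulr_sumr.
  under eq_bigr do rewrite nbrsE mulrC mulr_suml.
  by rewrite exchange_big /=; apply: ler_sum => y _; apply: level_sum_le.
have le1 : \sum_(x in U) \sum_(y in U) w x y <=
    \sum_(i < N) kappa / 16 ^+ i * (npairs (e i) U)%:R.
  apply: (@le_trans _ _ (\sum_(x in U) \sum_(y in U) \sum_(i < N)
      (level kappa i (w x y))%:R * (kappa / 16 ^+ i))).
    apply: ler_sum => x xU; apply: ler_sum => y yU; apply: level_sum_ge => //.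
      by rewrite w_ge0 le_k.
    exact: (Nlev (x, y)).
  under eq_bigr do rewrite exchange_big /=.
  rewrite exchange_big /= le_eqVlt; apply/orP; left; apply/eqP.
  apply: eq_bigr => i _; rewrite natr_sum mulr_sumr; apply: eq_bigr => x _.
  by rewrite degE natr_sum -mulr_suml mulrC.
have le2 : \sum_(i < N) kappa / 16 ^+ i * (npairs (e i) U)%:R <=
    4096 * p * (16 * \sum_(v in U) d v) + 2048 * p ^+ 2 * (16 * D)
      + 4 * (2 * kappa).
  apply: (@le_trans _ _ (\sum_(i < N) (
      4096 * p * (\sum_(v in U) kappa / 16 ^+ i * #|nbrs (e i) v|%:R)
      + 2048 * p ^+ 2 * (\sum_v kappa / 16 ^+ i * #|nbrs (e i) v|%:R)
      + 4 * (kappa / 16 ^+ i * (i ^ 3)%:R)))).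
    apply: ler_sum => i _; apply: le_trans (ler_wpM2l (k0 i) (npairs_i i)) _.
    rewrite /scaled_deg /mean_pairs natrM -!mulr_sumr le_eqVlt.
    by apply/orP; left; apply/eqP; set t := kappa / _; ring.
  rewrite 2!big_split /= -!mulr_sumr; apply: lerD; first apply: lerD.
  - apply: ler_wpM2l; first by rewrite mulr_ge0.
    by rewrite exchange_big /= mulr_sumr; apply: ler_sum.
  - apply: ler_wpM2l; first by rewrite mulr_ge0 ?exprn_ge0.
    by rewrite exchange_big /= mulr_sumr; apply: ler_sum.
  - by rewrite ler_pM2l //; apply: cube_sum_le.
have le3 : 4096 * p * (16 * \sum_(v in U) d v) <= 4096 * 16 * 1056 * (p ^+ 2 * D).
  have := ler_wpM2l p0 le_d; lra.
have pD : 0 < p ^+ 2 * D by rewrite mulr_gt0 ?exprn_gt0.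
move: lt_U; rewrite ltNge => /negP; apply.
(* In units of [p ^+ 2 * D] the total is [4096 * 16 * 1056 + 2048 * 16 + 8 * 16], below [2 ^ 27]. *)
apply: le_trans le1 (le_trans le2 _); rewrite /kappa; lra.
Qed.

End PairWeights.

(** * From edges to ordered pairs *)

Section EdgeSums.

Variables (R : realType) (V : finType) (G : sgraph V) (f : {set V} -> R).
Hypothesis f_ge0 : forall e, e \in edges G -> 0 <= f e.

Definition edge_weight (x y : V) : R := if adj G x y then f [set x; y] else 0.

Lemma adj_edges x y : adj G x y -> [set x; y] \in edges G.
Proof.
by move=> xy; rewrite inE; apply/existsP; exists x; apply/existsP; exists y;
  rewrite xy eqxx.
Qed.

Lemma edge_weight_ge0 x y : 0 <= edge_weight x y.
Proof. by rewrite /edge_weight; case: ifP => // /adj_edges /f_ge0. Qed.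

(** Every edge arises from at most two ordered pairs. *)
Lemma sum_edge_weight : \sum_x \sum_y edge_weight x y <= 2 * weight f (edges G).
Proof.
rewrite pair_bigA /= -big_mkcond /=.
rewrite (partition_big (fun u : V * V => [set u.1; u.2]) (mem (edges G))) /=;
  last by move=> u /adj_edges.
rewrite /weight mulr_sumr; apply: ler_sum => e eE.
rewrite (eq_bigr (fun=> f e)); last by move=> u /andP[_ /eqP ->].
rewrite sumr_const -[f e *+ _]mulr_natl ler_wpM2r ?f_ge0 // ler_nat.
move: eE; rewrite inE => /existsP[a /existsP[b /andP[_ /eqP ->]]].
apply: (@leq_trans #|[set (a, b); (b, a)]|); last by rewrite cards2; case: eqP.
apply/subset_leq_card/subsetP => -[x y]; rewrite !inE /= => /andP[xy /eqP E].
have nxy : x != y by apply: contraTneq xy => ->; rewrite adj_irrefl.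
have : x \in [set a; b] by rewrite -E !inE eqxx.
have : y \in [set a; b] by rewrite -E !inE eqxx orbT.
rewrite !inE !xpair_eqE.
by case/orP => /eqP yE /orP[] /eqP xE; move: nxy; rewrite xE yE !eqxx ?orbT.
Qed.

(** Every edge arises from at least one ordered pair, and the other terms are nonnegative. *)
Lemma weight_induced_le (U : {set V}) :
  weight f (induced_edges G U) <= \sum_(x in U) \sum_(y in U) edge_weight x y.
Proof.
pose A := [pred u : V * V | [&& u.1 \in U, u.2 \in U & adj G u.1 u.2]].
have -> : \sum_(x in U) \sum_(y in U) edge_weight x y =
    \sum_(u | A u) f [set u.1; u.2].
  rewrite pair_big /= [RHS]big_mkcond [LHS]big_mkcond; apply: eq_bigr => u _.
  by rewrite /edge_weight /=; case: (_ \in U); case: (_ \in U); case: adj.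
rewrite (partition_big (fun u : V * V => [set u.1; u.2])
    (mem (induced_edges G U))) /=; last first.
  move=> u /and3P[xU yU /adj_edges uE].
  by rewrite in_set uE subUset !sub1set xU yU.
apply: ler_sum => e; rewrite inE => /andP[eE eU].
have fe := f_ge0 eE; move: eE eU.
rewrite inE => /existsP[a /existsP[b /andP[ab /eqP eab]]].
rewrite eab subUset !sub1set => /andP[aU bU].
rewrite (bigD1 (a, b)) /= ?aU ?bU ?ab ?eqxx // lerDl; apply: sumr_ge0 => u.
by case/andP=> /andP[_ /eqP ->] _; rewrite -eab.
Qed.

End EdgeSums.

Theorem theorem1p6 (R : realType) :
  exists2 J : R, 0 < J &
    forall (V : finType) (G : sgraph V) (p : R) (lambda : {set V} -> R),
      0 <= p <= 1 ->
      (forall e, e \in edges G -> 0 <= lambda e) ->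
      heavy_family G lambda J p <> [set: {set V}] ->
      p_small p (heavy_family G lambda J p).
Proof.
(* Since [D <= 2 W], the pair threshold is at most [2 ^ 28 p^2 W], strictly below
   [J^2 p^2 W = 2 ^ 30 p^2 W]. *)
exists (2 ^+ 15); first exact: exprn_gt0.
move=> V G p lambda /andP[p_ge0 _] lambda_ge0.
have J0 : 0 < 2 ^+ 15 :> R by exact: exprn_gt0.
case/(heavy_family_neqT J0 p_ge0 lambda_ge0) => p_gt0 W_gt0.
set W := weight lambda (edges G) in W_gt0 *.
pose w := edge_weight G lambda.
have w_ge0 := edge_weight_ge0 lambda_ge0.
have w_sym x y : w x y = w y x by rewrite /w /edge_weight adj_sym setUC.
have w_diag x : w x x = 0 by rewrite /w /edge_weight adj_irrefl.
have leD := sum_edge_weight lambda_ge0.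
have leU := weight_induced_le lambda_ge0.
have geD : W <= \sum_x \sum_y w x y.
  have := leU setT; rewrite (_ : induced_edges G setT = edges G).
    by move/le_trans; apply; rewrite le_eqVlt; apply/orP; left; apply/eqP;
      apply: eq_big => [x|x _]; rewrite ?inE //; apply: eq_bigl => y; rewrite inE.
  by apply/setP => e; rewrite inE subsetT andbT.
have D_gt0 := lt_le_trans W_gt0 geD.
have [GG GGcov GGc] := coverable_pair_weight p_gt0 w_ge0 w_sym w_diag D_gt0.
exists GG; split=> // U; rewrite inE -/W => heavyU; apply: GGcov.
apply: lt_le_trans (le_trans heavyU (leU U)).
have pW : 0 < p ^+ 2 * W by rewrite mulr_gt0 ?exprn_gt0.
have := ler_wpM2l (exprn_ge0 2 p_ge0) leD.
rewrite -/W -/w -exprM => le_pD.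
have : 2 ^+ 27 * (p ^+ 2 * \sum_x \sum_y w x y) <= 2 ^+ 27 * (p ^+ 2 * (2 * W)).
  by rewrite ler_pM2l ?exprn_gt0.
lra.
Qed.
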